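(* Let $H=(V,E)$ be a $3$-graph on $n\ge 6$ vertices containing no copy of $K_5^{(3)}$, such that $H^{c}$ has more than one connected component. If $n=2m$, then $|E^{c}|\ge 2\binom{m}{3}$, equivalently $|E|\le m^2(m-1)$, with equality if and only if $H^{c}$ is the disjoint union of two copies of $K_m^{(3)}$. If $n=2m+1$, then $|E^{c}|\ge \binom{m}{3}+\binom{m+1}{3}$, equivalently $|E|\le m^3+\frac{m^2}{2}-\frac{m}{2}$, with equality if and only if $H^{c}$ is the disjoint union of $K_m^{(3)}$ and $K_{m+1}^{(3)}$.
   Context: A $3$-graph is a pair $(V,E)$ with $V$ finite and $E$ a set of $3$-element subsets of $V$. $K_s^{(3)}$ is the complete $3$-graph on $s$ vertices; ''$H$ contains no copy of $K_5^{(3)}$'' means there are no $5$ vertices all of whose $3$-subsets are edges. The complement is $H^{c}=(V,E^{c})$ with $E^{c}$ the set of $3$-subsets of $V$ not in $E$. Connected components are in the usual hypergraph sense, isolated vertices counting as components. *)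

(* Defs.v *)
From mathcomp Require Import all_boot all_order all_algebra.

Set Implicit Arguments.
Unset Strict Implicit.
Unset Printing Implicit Defensive.

Import Order.TTheory GRing.Theory Num.Theory.

(* A 3-graph on the vertex set V is given by its edge set E. *)
Definition is_3graph (V : finType) (E : {set {set V}}) : Prop :=
  forall e : {set V}, e \in E -> #|e| = 3.

Definition triples (V : finType) (A : {set V}) : {set {set V}} :=
  [set e : {set V} | (e \subset A) && (#|e| == 3)].

Definition compl3 (V : finType) (E : {set {set V}}) : {set {set V}} :=
  triples [set: V] :\: E.

Definition contains_K3 (V : finType) (s : nat) (E : {set {set V}}) : Prop :=
  exists S : {set V}, #|S| = s /\ triples S \subset E.

Definition hadj (V : finType) (E : {set {set V}}) : rel V :=
  fun x y => [exists e in E, (x \in e) && (y \in e)].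

Lemma hadj_connect_sym (V : finType) (E : {set {set V}}) :
  connect_sym (hadj E).
Proof.
apply: sym_connect_sym => x y; rewrite /hadj.
by apply: eq_existsb => e; rewrite [(x \in e) && _]andbC.
Qed.

(* Classes of the connectedness relation on all of V, so that a vertex lying
   on no edge is a component by itself. *)
Definition num_components (V : finType) (E : {set {set V}}) : nat :=
  n_comp (hadj E) [set: V].

(* The 3-graph (V, E) is the vertex-disjoint union of a complete 3-graph on a
   vertices and one on b vertices; these exhaust V. *)
Definition is_disjoint_union_K3 (V : finType) (a b : nat)
    (E : {set {set V}}) : Prop :=
  exists A B : {set V},
    [/\ A :|: B = [set: V], [disjoint A & B], #|A| = a, #|B| = b
      & E = triples A :|: triples B].

(* Main.v *)
Require Import Defs.
From mathcomp Require Import all_boot all_order all_algebra.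
From mathcomp Require Import zify lra.
Import Order.TTheory GRing.Theory Num.Theory.

Set Implicit Arguments.
Unset Strict Implicit.
Unset Printing Implicit Defensive.

(** Write [G] for the complement of [E]: every 5-set of vertices contains an
    edge of [G]. Split [V] into nonempty [A] and [B] not joined by an edge of
    [G]. If both have at least two vertices, adding two vertices of [B] to a
    triple of [A] shows that this triple is an edge, so [G] is the union of the
    cliques on [A] and [B], and only the balance of the two sizes matters. If
    [A] is a single vertex, then every 4-subset of [B] contains an edge, hence
    (double counting) every 5-subset of [B] contains at least [5/2], that is 3,
    edges, so [G] has at least [3/10 * 'C(n - 1, 3)] edges. This exceeds the
    optimum, whereas the bound [1/4 * 'C(n - 1, 3)] coming from 4-subsets alone
    only equals it for odd [n]. *)

(** Both sides estimate the number of pairs [e \subset S \subset B] with [e] in [F] and [#|S| = k]: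
    from below over [S], from above over [e]. *)
Lemma double_count_subsets (T : finType) (F : {set {set T}}) (B : {set T})
    (r k c : nat) :
  (forall e, e \in F -> #|e| = r) ->
  (forall S : {set T}, S \subset B -> #|S| = k ->
     c <= #|[set e in F | e \subset S]|) ->
  c * 'C(#|B|, k) <= #|[set e in F | e \subset B]| * 'C(#|B| - r, k - r).
Proof.
move=> hF hc; pose D := [set S : {set T} | S \subset B & #|S| == k].
rewrite -cards_draws -/D mulnC -sum_nat_const.
apply: (@leq_trans (\sum_(S in D) \sum_(e in F | e \subset S) 1)).
  apply: leq_sum => S; rewrite inE => /andP[SB /eqP Sk].
  by rewrite sum1_card; have := hc S SB Sk; rewrite cardsE.
rewrite (exchange_big_dep (fun e => e \in [set e in F | e \subset B])) /=; last first.
  move=> S e; rewrite !inE => /andP[SB _] /andP[-> eS] /=.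
  exact: subset_trans eS SB.
rewrite -sum_nat_const; apply: leq_sum => e; rewrite inE => /andP[eF eB].
have -> : #|B| - r = #|B :\: e| by rewrite cardsDS ?(hF e).
rewrite -cards_draws sum1_card -cardsE.
(* Removing [e] is injective on the sets containing [e], and sends the sets counted here to
   [(k - r)]-subsets of [B :\: e]. *)
rewrite -(@card_in_imset _ _ (fun S => S :\: e)) => [|S1 S2].
  apply/subset_leq_card/subsetP => _ /imsetP[S + ->].
  rewrite inE => /and3P[+ _ eS]; rewrite !inE => /andP[SB /eqP Sk].
  by rewrite setSD //= cardsDS // Sk (hF e).
rewrite !inE => /and3P[_ _ eS1] /and3P[_ _ eS2] eqD.
by rewrite -(setID S1 e) -(setID S2 e) eqD (setIidPr eS1) (setIidPr eS2).
Qed.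

(** * Arithmetic of ['C(n, 3)] and of balanced products *)

Lemma bin3_poly (n : nat) : 6 * 'C(n, 3) + 3 * n ^ 2 = n ^ 3 + 2 * n.
Proof.
rewrite mulnC (bin_ffact n 3) !ffactnS ffactn0 muln1.
by case: n => [|[|n]] //; rewrite !succnK; nia.
Qed.

(** A triple meeting both parts contains exactly two crossing pairs, and each of the [a * b]
    crossing pairs extends in [a + b - 2] ways. For a fixed sum, minimizing the two binomials thus
    means maximizing [a * b]. *)
Lemma bin3_split (a b : nat) :
  2 * ('C(a, 3) + 'C(b, 3)) + (a + b - 2) * (a * b) = 2 * 'C(a + b, 3).
Proof.
have := bin3_poly a; have := bin3_poly b; have := bin3_poly (a + b).
move: 'C(a, 3) 'C(b, 3) 'C(a + b, 3) => x y z.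
have [lt2|ge2] := ltnP (a + b) 2.
  by case: a b lt2 => [|[|a]] [|[|b]] //; lia.
have : (a + b - 2) * (a * b) + 2 * (a * b) = (a + b) * (a * b).
  by rewrite -mulnDl subnK.
move: ((a + b - 2) * (a * b)) => w; lia.
Qed.

(** By AM-GM, [4ab <= (p + q)^2 <= 4pq + 1], and integrality absorbs the 1. *)
Lemma mul_balanced (a b p q : nat) :
  a + b = p + q -> p <= q <= p.+1 -> a * b <= p * q.
Proof.
move=> abpq /andP[pq qp]; have := (nat_AGM2 a b).1; rewrite abpq.
have [->|->] : q = p \/ q = p.+1 by lia.
all: move: (a * b) => x; nia.
Qed.

(** Sum and product determine the squared difference [(a + b)^2 - 4ab]. *)
Lemma mul_balanced_eq (a b p q : nat) :
  a + b = p + q -> p <= q -> a <= b -> a * b = p * q -> a = p.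
Proof.
move=> sum_eq /subnKC qE /subnKC bE; move: sum_eq; rewrite -qE -bE.
move: (b - a) (q - p) => d e sum_eq mul_eq.
have : (a + (a + d)) ^ 2 = (p + (p + e)) ^ 2 by rewrite sum_eq.
move=> sqr_eq; have /eqP : d ^ 2 = e ^ 2 by lia.
by rewrite eqn_exp2r // => /eqP; lia.
Qed.

(** This strict gap rules out equality when one side is a single vertex. *)
Lemma balanced_bin3_lt (p q : nat) :
  p <= q <= p.+1 -> 6 <= p + q ->
  10 * ('C(p, 3) + 'C(q, 3)) < 3 * 'C((p + q).-1, 3).
Proof.
move=> pq; have := bin3_split p q.
have := bin3_poly (p + q); have := bin3_poly (p + q).-1.
have : (p + q) ^ 2 <= 4 * (p * q) + 1 by nia.
move: (p * q) (p + q) => x [|[|s]] //; rewrite succnK subSS subSS subn0.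
move: 'C(p, 3) 'C(q, 3) 'C(s.+1, 3) 'C(s.+2, 3) => Cp Cq C1 C2.
move=> h1 h2 h3 h4 h5.
(* Here [s] is [p + q - 2]; the product [s * x] is the crossing term of [bin3_split]. *)
have : s * (s.+2 ^ 2) <= s * (4 * x + 1) by rewrite leq_mul.
nia.
Qed.

(** * Splitting a disconnected 3-graph and counting edges on its sides *)

Lemma card_triples (V : finType) (A : {set V}) : #|triples A| = 'C(#|A|, 3).
Proof. exact: cards_draws. Qed.

Lemma card_triplesU (V : finType) (A B : {set V}) : [disjoint A & B] ->
  #|triples A :|: triples B| = 'C(#|A|, 3) + 'C(#|B|, 3).
Proof.
move=> dAB; rewrite cardsU !card_triples [_ :&: _](_ : _ = set0) ?cards0 ?subn0//.
apply/setP=> e; rewrite !inE; apply/negP=> /andP[/andP[eA e3] /andP[eB _]].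
have : e \subset A :&: B by rewrite subsetI eA.
by rewrite (disjoint_setI0 dAB) subset0 => /eqP e0; rewrite e0 cards0 in e3.
Qed.

(** One side is the component of a root [x]; a second root [y] lies outside it, and an edge meeting
    the component stays inside. *)
Lemma disconnected_split (V : finType) (G : {set {set V}}) :
  1 < num_components G ->
  exists A : {set V}, [/\ 0 < #|A|, 0 < #|~: A| &
    forall e, e \in G -> (e \subset A) || (e \subset ~: A)].
Proof.
rewrite /num_components /n_comp_mem => /card_gt1P[x [y [rx ry xy]]].
move: rx ry; rewrite !inE !andbT => /eqP rx /eqP ry.
exists [set z | connect (hadj G) x z]; split.
- by apply/card_gt0P; exists x; rewrite inE connect0.
- apply/card_gt0P; exists y; rewrite !inE -(root_connect (@hadj_connect_sym _ G)).
  by rewrite rx ry.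
move=> e eG; case: (boolP (e \subset ~: _)) => [|/subsetPn[z ze]].
  by rewrite orbT.
rewrite !inE negbK orbF => xz; apply/subsetP=> t te; rewrite inE.
apply: connect_trans xz (connect1 _).
by apply/existsP; exists e; rewrite eG ze te.
Qed.

Lemma triples_sub_side (V : finType) (G : {set {set V}}) (A : {set V}) :
  is_3graph G ->
  (forall e, e \in G -> (e \subset A) || (e \subset ~: A)) ->
  (forall S : {set V}, #|S| = 5 -> exists2 e, e \in G & e \subset S) ->
  2 <= #|~: A| -> triples A \subset G.
Proof.
move=> G3 Gsplit G5 /card_geqP[s [us ss sA]].
have dAs : [disjoint A & [set x in s]].
  rewrite disjoint_sym disjoints_subset; apply/subsetP => x.
  by rewrite !inE => /sA; rewrite inE.
have cs : #|[set x in s]| = 2 by rewrite cardsE (card_uniqP us).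
apply/subsetP => t; rewrite inE => /andP[tA /eqP t3].
have dts : [disjoint t & [set x in s]] := disjointWl tA dAs.
have [|e eG et] := G5 (t :|: [set x in s]).
  by rewrite cardsU (disjoint_setI0 dts) cards0 t3 cs.
case/orP: (Gsplit _ eG) => eA.
  have : e \subset t.
    apply/subsetP => x xe; move/subsetP/(_ x xe): et; rewrite in_setU.
    case/orP => // xs; have := disjointFl dAs xs.
    by rewrite (subsetP eA).
  move=> et'; suff -> : t = e by [].
  by apply/esym/eqP; rewrite eqEcard et' t3 (G3 _ eG).
(* On the other side [e] would have to fit into the two added vertices. *)
have : #|e| <= #|[set x in s]|.
  apply/subset_leq_card/subsetP => x xe; move/subsetP/(_ x xe): et; rewrite in_setU.
  case/orP => // xt; move/subsetP/(_ x xe): eA.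
  by rewrite in_setC (subsetP tA).
by rewrite cs (G3 _ eG).
Qed.

Lemma card_edges_singleton_side (V : finType) (G : {set {set V}}) (A : {set V}) :
  is_3graph G ->
  (forall e, e \in G -> (e \subset A) || (e \subset ~: A)) ->
  (forall S : {set V}, #|S| = 5 -> exists2 e, e \in G & e \subset S) ->
  #|A| = 1 -> 5 <= #|~: A| -> 3 * 'C(#|~: A|, 3) <= 10 * #|G|.
Proof.
move=> G3 Gsplit G5 /eqP/cards1P[x Ax] B5.
(* Adjoining [x] to [S] gives a 5-set; its edge is too large for the side [A], so it avoids [x]. *)
have h4 (S : {set V}) : S \subset ~: A -> #|S| = 4 ->
    1 <= #|[set e in G | e \subset S]|.
  move=> SB S4; have xS : x \notin S.
    by apply/negP => /(subsetP SB); rewrite Ax !inE eqxx.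
  have [|e eG eS] := G5 (x |: S); first by rewrite cardsU1 xS S4.
  apply/card_gt0P; exists e; rewrite inE eG /=.
  case/orP: (Gsplit _ eG) => eA.
    by move/subset_leq_card: eA; rewrite Ax cards1 (G3 _ eG).
  apply/subsetP => y ye; move/subsetP/(_ y ye): eS; rewrite !inE.
  by move/subsetP/(_ y ye): eA; rewrite Ax !inE => /negbTE ->.
have h5 (S : {set V}) : S \subset ~: A -> #|S| = 5 ->
    3 <= #|[set e in G | e \subset S]|.
  move=> SB S5.
  have /(double_count_subsets G3) : forall S' : {set V}, S' \subset S ->
      #|S'| = 4 -> 1 <= #|[set e in G | e \subset S']|.
    by move=> S' S'S; apply/h4/(subset_trans S'S).
  by rewrite S5 (_ : 'C(5, 4) = 5) // (_ : 'C(5 - 3, 4 - 3) = 2) //; lia.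
have := double_count_subsets G3 h5.
move: B5; set b := #|~: A| => B5 h.
have {}h : 3 * 'C(b, 5) <= #|G| * 'C(b - 3, 2).
  apply: leq_trans h _; rewrite leq_mul2r; apply/orP; right.
  by apply/subset_leq_card/subsetP => e; rewrite inE => /andP[].
have e4 := mul_bin_left b 4; have e3 := mul_bin_left b 3.
have e2 := mul_bin_left (b - 3) 1; rewrite bin1 -subnDA in e2.
(* Both sides count 3-sets inside 5-sets; this lets ['C(b - 3, 2)] cancel and leaves the density
   3/10. *)
have e5 : 'C(b, 5) * 10 = 'C(b, 3) * 'C(b - 3, 2).
  have := congr1 (muln (b - 4)) e3; have := congr1 (muln 'C(b, 3)) e2.
  by move: (b - 4) (b - 3) e2 e3 e4 => u v; lia.
have : 0 < 'C(b - 3, 2) by rewrite bin_gt0; lia.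
by move=> C0; rewrite -(leq_pmul2r C0) -!mulnA -e5 mulnA mulnC leq_mul2l h orbT.
Qed.

Lemma disconnected_bound (V : finType) (G : {set {set V}}) (p q : nat) :
  is_3graph G ->
  (forall S : {set V}, #|S| = 5 -> exists2 e, e \in G & e \subset S) ->
  1 < num_components G -> p <= q <= p.+1 -> p + q = #|V| -> 6 <= #|V| ->
  'C(p, 3) + 'C(q, 3) <= #|G| /\
  (#|G| = 'C(p, 3) + 'C(q, 3) <-> is_disjoint_union_K3 p q G).
Proof.
move=> G3 G5 /disconnected_split[A0 [A0gt B0gt split0]] pq pqV V6.
(* With [A] the smaller side, [2 <= #|A|] makes both sides large enough for [triples_sub_side], and
   the order matches [p <= q]. *)
have [A [Agt0 AB split]] : exists A : {set V}, [/\ 0 < #|A|, #|A| <= #|~: A| &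
    forall e, e \in G -> (e \subset A) || (e \subset ~: A)].
  have [le|/ltnW le] := leqP #|A0| #|~: A0|; first by exists A0.
  exists (~: A0); split; rewrite ?setCK // => e /split0.
  by rewrite orbC.
have cV : #|A| + #|~: A| = p + q by rewrite cardsC pqV.
have of_union : is_disjoint_union_K3 p q G -> #|G| = 'C(p, 3) + 'C(q, 3).
  by move=> [X [Y [_ D <- <- ->]]]; rewrite card_triplesU.
have [A1|A2] : #|A| = 1 \/ 2 <= #|A| by lia.
  have := card_edges_singleton_side G3 split G5 A1.
  have := balanced_bin3_lt pq; rewrite pqV => /(_ V6).
  have -> : #|V|.-1 = #|~: A| by lia.
  by move=> lt /(_ ltac:(lia)) le; split; [lia | split => // eqG; lia].
have splitC e : e \in G -> (e \subset ~: A) || (e \subset ~: ~: A).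
  by move=> /split; rewrite setCK orbC.
have GE : G = triples A :|: triples (~: A).
  apply/eqP; rewrite eqEsubset subUset (triples_sub_side G3 split G5); last lia.
  rewrite (triples_sub_side G3 splitC G5) ?setCK // !andbT.
  apply/subsetP => e eG; rewrite !inE (G3 _ eG) eqxx !andbT.
  exact: split.
have dA : [disjoint A & ~: A] by rewrite -setI_eq0 setICr.
have cG : #|G| = 'C(#|A|, 3) + 'C(#|~: A|, 3).
  by rewrite {1}GE card_triplesU.
(* Both splittings have the same total, so comparing [#|G|] with the optimum reduces to comparing
   products of side sizes. *)
have sA := bin3_split #|A| #|~: A|; have sp := bin3_split p q.
rewrite cV -cG in sA.
have le_mul : (p + q - 2) * (#|A| * #|~: A|) <= (p + q - 2) * (p * q).
  by rewrite leq_mul // mul_balanced.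
split; first by lia.
split=> // eqG; have /eqP : (p + q - 2) * (#|A| * #|~: A|) = (p + q - 2) * (p * q).
  by lia.
rewrite eqn_pmul2l; last by lia.
move=> /eqP/(mul_balanced_eq cV (andP pq).1 AB) Ap.
by exists A, (~: A); split; rewrite ?setUCr //; lia.
Qed.

(** * Passing between [E] and its complement *)

Lemma edge_in_5sets (V : finType) (E : {set {set V}}) :
  ~ contains_K3 5 E ->
  forall S : {set V}, #|S| = 5 -> exists2 e, e \in compl3 E & e \subset S.
Proof.
move=> hK5 S S5; case: (boolP (triples S \subset E)) => [sE|].
  by case: hK5; exists S.
case/subsetPn => e; rewrite inE => /andP[eS e3] eE.
by exists e; rewrite // !inE eE subsetT.
Qed.

Lemma card_compl3 (V : finType) (E : {set {set V}}) :
  is_3graph E -> #|E| + #|compl3 E| = 'C(#|V|, 3).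
Proof.
move=> hE; rewrite -[in RHS]cardsT -card_triples.
rewrite -(cardsID E (triples _)) (setIidPr _) //.
by apply/subsetP => e /hE e3; rewrite inE subsetT e3.
Qed.

Theorem theorem3p2 (V : finType) (E : {set {set V}}) (n : nat)
    (hE : is_3graph E)
    (hn : #|V| = n) (hn6 : 6 <= n)
    (hK5 : ~ contains_K3 5 E)
    (hcomp : 1 < num_components (compl3 E)) :
  (forall m : nat, n = 2 * m ->
     [/\ 2 * 'C(m, 3) <= #|compl3 E|,
         #|E| <= m ^ 2 * (m - 1),
         #|compl3 E| = 2 * 'C(m, 3) <-> is_disjoint_union_K3 m m (compl3 E)
       & #|E| = m ^ 2 * (m - 1) <-> is_disjoint_union_K3 m m (compl3 E)])
  /\
  (forall m : nat, n = 2 * m + 1 ->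
     [/\ 'C(m, 3) + 'C(m.+1, 3) <= #|compl3 E|,
         (#|E|%:R <= m%:R ^+ 3 + m%:R ^+ 2 / 2%:R - m%:R / 2%:R :> rat)%R,
         #|compl3 E| = 'C(m, 3) + 'C(m.+1, 3) <->
           is_disjoint_union_K3 m m.+1 (compl3 E)
       & (#|E|%:R = m%:R ^+ 3 + m%:R ^+ 2 / 2%:R - m%:R / 2%:R :> rat)%R <->
           is_disjoint_union_K3 m m.+1 (compl3 E)]).
Proof.
have G3 : is_3graph (compl3 E) by move=> e; rewrite !inE => /and3P[_ _ /eqP].
have bound p q := @disconnected_bound V _ p q G3 (edge_in_5sets hK5) hcomp.
have cE := card_compl3 hE; rewrite hn in bound cE.
split=> m nm.
  have [|||lb eqb] := bound m m; try lia.
  have sp := bin3_split m m.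
  have [m1 [em hm]] : exists m1, m - 1 = m1 /\ m + m - 2 = 2 * m1.
    by exists (m - 1); lia.
  rewrite em hm in sp *; have {}nm : m + m = n by lia.
  rewrite nm -cE in sp.
  rewrite mul2n -addnn; split => //; first by nia.
  by rewrite -eqb; split; nia.
have [|||lb eqb] := bound m m.+1; try lia.
have sp := bin3_split m m.+1.
have {}nm : m + m.+1 = n by lia.
rewrite nm -cE in sp.
(* The crossing term [(2m - 1)m(m + 1)] is [2m^3 + m^2 - m]; moving [m] across avoids truncated
   subtraction. *)
have {}sp : 2 * ('C(m, 3) + 'C(m.+1, 3)) + (2 * m ^ 3 + m ^ 2) =
    2 * (#|E| + #|compl3 E|) + m.
  by case: (m) nm sp => [|k] nm; rewrite -nm; nia.
(* The rational bound exceeds [#|E|] by exactly the excess of [#|compl3 E|] over its minimum. *)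
have rat_half : (m%:R ^+ 3 + m%:R ^+ 2 / 2%:R - m%:R / 2%:R =
    #|E|%:R + (#|compl3 E|%:R - ('C(m, 3) + 'C(m.+1, 3))%:R) :> rat)%R.
  have := congr1 (fun k : nat => k%:R%R : rat) sp.
  rewrite !(natrD, natrM, natrX); lra.
split=> //.
  by rewrite rat_half lerDl subr_ge0 ler_nat.
rewrite -eqb rat_half; split=> [|->]; last by rewrite subrr addr0.
move=> /eqP; rewrite eq_sym addrC -subr_eq0 addrK subr_eq0 eqr_nat.
by move/eqP.
Qed.
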